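(* Let $X,Y,Z$ be locally convex Hausdorff topological vector spaces, $K\subset Y$ a proper closed convex cone with $\operatorname{int}K\neq\emptyset$, and $S\subset Z$ a nonempty convex cone with $\operatorname{int}S\neq\emptyset$. Let $\Phi\colon X\times Z\to Y^\infty$ be a proper $K$-convex mapping with $0_Z\in\pi(\operatorname{dom}\Phi)$, where $\pi(x,z)=z$. Assume that $0_Z\in\pi(\operatorname{dom}\Phi)-\operatorname{int}S$ and that $\Phi(x,0_Z)\leqq_K\Phi(x,z)$ whenever $(x,z)\in\operatorname{dom}\Phi$ and $z\in S$. Then $$\operatorname{epi}\Phi(\cdot,0_Z)^*=\bigcup_{T\in\mathcal L_\Phi}\operatorname{epi}\Phi^*(\cdot,T)=\bigcup_{T\in\mathcal L_\Phi^+}\operatorname{epi}\Phi^*(\cdot,T).$$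
   Context: Ordering: $K$ proper means $K\ne Y$. $y_1\leqq_K y_2$ iff $y_1-y_2\in-K$; $y_1<_K y_2$ iff $y_1-y_2\in-\operatorname{int}K$. $Y^\infty=Y\cup\{+\infty_Y\}$, $Y^\bullet=Y\cup\{-\infty_Y,+\infty_Y\}$, where $-\infty_Y<_K y<_K+\infty_Y$ for $y\in Y$, $-\infty_Y<_K+\infty_Y$, $-(+\infty_Y)=-\infty_Y$, $y+(\pm\infty_Y)=\pm\infty_Y$ for $y\in Y$; in particular $+\infty_Y\not\leqq_K y$ for $y\in Y$. Weak supremum: for $M\subset Y^\bullet$, $\operatorname{WSup}M$ is the set of $\bar v\in Y^\bullet$ such that $\bar v\not<_K v$ for all $v\in M$ and for every $\tilde v\in Y^\bullet$ with $\tilde v<_K\bar v$ there is $v\in M$ with $\tilde v<_K v$. $\mathcal L(X,Y)$ is the space of continuous linear maps $X\to Y$. For $\Phi\colon X\times Z\to Y^\infty$: $\operatorname{dom}\Phi=\{(x,z):\Phi(x,z)\neq+\infty_Y\}$; $\Phi$ is proper if $\operatorname{dom}\Phi\ne\emptyset$; $\Phi$ is $K$-convex if $\{(x,z,y)\in X\times Z\times Y:y\in\Phi(x,z)+K\}$ is convex. Conjugates: $\Phi^*(L,T)=\operatorname{WSup}\{L(x)+T(z)-\Phi(x,z):(x,z)\in X\times Z\}$ for $(L,T)\in\mathcal L(X,Y)\times\mathcal L(Z,Y)$; $\Phi(\cdot,0_Z)^*(L)=\operatorname{WSup}\{L(x)-\Phi(x,0_Z):x\in X\}$. $\operatorname{epi}\Phi(\cdot,0_Z)^*=\{(L,y)\in\mathcal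 L(X,Y)\times Y:y\in\Phi(\cdot,0_Z)^*(L)+K\}$ and $\operatorname{epi}\Phi^*(\cdot,T)=\{(L,y)\in\mathcal L(X,Y)\times Y:y\in\Phi^*(L,T)+K\}$ (where $\{\pm\infty_Y\}+K=\{\pm\infty_Y\}$). $\mathcal L_\Phi=\{T\in\mathcal L(Z,Y):\exists L\in\mathcal L(X,Y),\ \Phi^*(L,T)\neq\{+\infty_Y\}\}$, $\mathcal L_+(S,K)=\{T\in\mathcal L(Z,Y):T(S)\subset K\}$, $\mathcal L_\Phi^+=\mathcal L_\Phi\cap\mathcal L_+(S,K)$. *)

(* Defs.v *)
From HB Require Import structures.
From mathcomp Require Import all_boot all_order all_algebra.
From mathcomp Require Import boolp classical_sets functions reals.
From mathcomp Require Import constructive_ereal topology convex tvs.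

Set Implicit Arguments.
Unset Strict Implicit.
Unset Printing Implicit Defensive.

Import Order.TTheory GRing.Theory Num.Theory.

Local Open Scope classical_set_scope.
Local Open Scope ring_scope.

(* A cone is stable under multiplication by positive scalars; it need not
   contain the origin unless it is closed and nonempty. *)
Definition convex_cone (R : realType) (E : lmodType R) (C : set E) : Prop :=
  convex_set C /\ (forall (t : R) (x : E), 0 < t -> C x -> C (t *: x)).

(* The completion of Y by -oo and +oo is the library's [\bar Y], whose addition
   and opposite are defined over any additive group: y%:E + (+oo) = +oo,
   y%:E + (-oo) = -oo and - (+oo) = -oo. A map into Y with +oo adjoined is a map
   into [\bar Y] that never takes the value -oo. *)

(* [leK] is reflexive, and [ltK] irreflexive, at -oo and at +oo. *)
Definition leK (R : realType) (Y : tvsType R) (K : set Y) (a b : \bar Y) : Prop :=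
  match a, b with
  | EFin y1, EFin y2 => [set - k | k in K] (y1 - y2)
  | ENInf, _ => True
  | _, EPInf => True
  | _, _ => False
  end.

Definition ltK (R : realType) (Y : tvsType R) (K : set Y) (a b : \bar Y) : Prop :=
  match a, b with
  | EFin y1, EFin y2 => [set - k | k in K°] (y1 - y2)
  | ENInf, EFin _ => True
  | EFin _, EPInf => True
  | ENInf, EPInf => True
  | _, _ => False
  end.

Definition WSup (R : realType) (Y : tvsType R) (K : set Y) (M : set (\bar Y)) :
    set (\bar Y) :=
  [set v | (forall m, M m -> ~ ltK K v m) /\
           (forall w, ltK K w v -> exists2 m, M m & ltK K w m)].

Definition addK (R : realType) (Y : tvsType R) (A : set (\bar Y)) (K : set Y) :
    set (\bar Y) :=
  [set (a + k%:E)%E | a in A & k in K].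

Definition clinear (R : realType) (X Y : tvsType R) : set {linear X -> Y} :=
  [set L | continuous L].
Arguments clinear {R} X Y.

Section perturbation.
Context {R : realType} {X Y Z : tvsType R}.
Implicit Types (K : set Y) (S : set Z) (Phi : X * Z -> \bar Y).

Definition vdom Phi : set (X * Z) := [set p | Phi p <> +oo%E].

Definition vproper Phi : Prop := vdom Phi !=set0.

Definition Kconvex K Phi : Prop :=
  convex_set [set p : X * Z * Y | addK [set Phi p.1] K p.2%:E].

Definition conj1 K (F : X -> \bar Y) (L : {linear X -> Y}) : set (\bar Y) :=
  WSup K [set ((L x)%:E - F x)%E | x in [set: X]].

Definition conj2 K Phi (L : {linear X -> Y}) (T : {linear Z -> Y}) :
    set (\bar Y) :=
  WSup K [set ((L p.1 + T p.2)%:E - Phi p)%E | p in [set: X * Z]].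

(* The epigraph of a set-valued map on the continuous linear maps. *)
Definition epi K (F : {linear X -> Y} -> set (\bar Y)) :
    set ({linear X -> Y} * Y) :=
  [set Ly | clinear X Y Ly.1 /\ addK (F Ly.1) K Ly.2%:E].

Definition calL K Phi : set {linear Z -> Y} :=
  [set T | clinear Z Y T /\
           exists2 L, clinear X Y L & conj2 K Phi L T <> [set +oo%E]].

Definition Lplus S K : set {linear Z -> Y} :=
  [set T | clinear Z Y T /\ T @` S `<=` K].

Definition calLplus S K Phi : set {linear Z -> Y} :=
  calL K Phi `&` Lplus S K.

End perturbation.

(* Main.v *)
Require Import Defs.
From HB Require Import structures.
From mathcomp Require Import all_boot all_order all_algebra interval_inference.
From mathcomp Require Import lra.
From mathcomp Require Import boolp classical_sets functions reals.
From mathcomp Require Import constructive_ereal topology convex tvs.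
From mathcomp Require Import num_normedtype pseudometric_normed_Zmodule.

(* The upper closures of the weak suprema are described by [y] not lying
   strictly below any element, so the equalities reduce to the following: if
   [L x - Phi (x, 0) - y] never meets [int K], then a single continuous [T] with
   [T S] in [K] keeps [L x + T z - Phi (x, z) - y] out of [int K] for all
   [(x, z)]. By monotonicity along [S] and convexity, the wedge in [Y * Z]
   spanned by the points [(y + u - L x, - z)], [(x, z, u)] in the epigraph of
   [Phi], and by [K * S] misses [- (e, 0)] for [e] in [int K], while the
   qualification condition makes [(e, 0)] an order unit of it. A normalized
   positive functional [f] on this wedge gives [T z = f (0, z) e], whose
   continuity follows from its positivity on [S], which has interior points. *)

Set Implicit Arguments.
Unset Strict Implicit.
Unset Printing Implicit Defensive.

Import Order.TTheory GRing.Theory Num.Theory.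
Import numFieldTopology.Exports.
Local Open Scope classical_set_scope.
Local Open Scope ring_scope.

(** Convexity is encoded as stability under sums and the origin is included, so that a wedge is
    exactly the nonnegative cone of a vector preorder. *)
Definition wedge (R : realType) (E : lmodType R) (C : set E) : Prop :=
  [/\ C 0, forall x y, C x -> C y -> C (x + y) &
      forall (t : R) x, 0 < t -> C x -> C (t *: x)].

(** * Extension of wedges and normalized positive functionals *)

Section wedge_functional.
Context {R : realType} {E : lmodType R}.
Implicit Types (P Q : set E) (e x : E).

Lemma wedgeZ P (t : R) x : wedge P -> 0 <= t -> P x -> P (t *: x).
Proof.
move=> [P0 _ PZ]; rewrite le_eqVlt => /predU1P[<- _|]; last exact: PZ.
by rewrite scale0r.
Qed.

(** Zorn's lemma on the wedges above [P] that omit [- e]: by maximality, adjoining the ray of any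
    [x] outside [Q] must bring in [- e]. *)
Lemma maximal_wedge P e : wedge P -> ~ P (- e) ->
  exists Q, [/\ wedge Q, P `<=` Q, ~ Q (- e) &
    forall x, ~ Q x -> exists2 t : R, 0 < t & Q (- e - t *: x)].
Proof.
move=> wP Pe.
(* Zorn's lemma bears on the part added to [P], so that the empty chain, whose union is empty, still
   yields the wedge [P]. *)
have [F FP totF|A [[wA Ae] Amax]] :=
    @Zorn_bigcup E [set A | wedge (P `|` A) /\ ~ (P `|` A) (- e)].
  have common x y : (P `|` \bigcup_(X in F) X) x ->
      (P `|` \bigcup_(X in F) X) y -> exists2 X, F X \/ X = set0 &
      (P `|` X) x /\ (P `|` X) y.
    move=> [Px|[A FA Ax]] [Py|[B FB By]].
    - by exists set0; [right|split; left].
    - by exists B; [left|split; [left|right]].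
    - by exists A; [left|split; [right|left]].
    - have [AB|BA] := totF _ _ FA FB.
        by exists B; [left|split; right; [exact: AB|]].
      by exists A; [left|split; right; [|exact: BA]].
  have sub X : F X \/ X = set0 ->
      [/\ wedge (P `|` X), P `|` X `<=` P `|` \bigcup_(X in F) X
        & ~ (P `|` X) (- e)].
    move=> [FX|->]; last by rewrite setU0; split => // x Px; left.
    have [wX Xe] := FP _ FX; split => // x [Px|Xx]; [by left|right].
    by exists X.
  split.
    split; first by left; case: wP.
      move=> x y Ax Ay.
        have [X /sub[[_ XD _] XS _] [Xx Xy]] := common _ _ Ax Ay.
        exact/XS/XD.
    move=> t x t0 Ax; have [X /sub[[_ _ XZ] XS _] [Xx _]] := common _ _ Ax Ax.
    exact/XS/XZ.
  by move=> Ae; have [X /sub[_ _ Xe] [/Xe]] := common _ _ Ae Ae.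
exists (P `|` A); split => // x Qx; apply: contrapT => ntx.
have [Q0 QD QZ] := wA.
pose B : set E := [set u | exists2 q, (P `|` A) q &
  exists2 t : R, 0 <= t & u = q + t *: x].
have AB : P `|` A `<=` B.
  by move=> q Aq; exists q => //; exists 0; rewrite ?scale0r ?addr0.
apply: (Amax B).
  split=> [q Aq|BA]; first by apply: AB; right.
  apply: Qx; right; apply: BA.
  by exists 0 => //; exists 1 => //; rewrite add0r scale1r.
have PB : P `|` B = B by rewrite setUidr// => q Pq; apply: AB; left.
suff : wedge B /\ ~ B (- e) by rewrite -[in X in X -> _]PB.
split; first split.
- exact: AB.
- move=> _ _ [p Ap [s s0 ->]] [q Aq [t t0 ->]]; exists (p + q); first exact: QD.
  by exists (s + t); [exact: addr_ge0|rewrite scalerDl addrACA].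
- move=> r _ r0 [q Aq [t t0 ->]]; exists (r *: q); first exact: QZ.
  by exists (r * t); [rewrite mulr_ge0// ltW|rewrite scalerDr scalerA].
- move=> [q Aq [t t0 eq]]; apply: ntx.
  move: t0 eq; rewrite le_eqVlt => /predU1P[<-|t0 ->].
    by rewrite scale0r addr0 => eq; case: Ae; rewrite eq.
  by exists t => //; rewrite addrK.
Qed.

(* A maximal wedge omitting [- e] totally preorders [E] with order unit [e], so
   that every [x] is squeezed between multiples of [e]. *)
Lemma wedge_functional P e : wedge P -> ~ P (- e) ->
    (forall x, exists t : R, P (x + t *: e)) ->
  exists f : {scalar E}, f e = 1 /\ (forall x, P x -> 0 <= f x).
Proof.
move=> wP Pe Punit.
have [Q [wQ PQ Qe Qmax]] := maximal_wedge wP Pe; have [Q0 QD QZ] := wQ.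
(* If both [x] and [- x] were outside [Q], then [- e] would be the combination of [- e - t *: x] and
   [- e + s *: x] in which [x] cancels. *)
have Qtot x : ~ Q x -> Q (- x).
  move=> Qx; have [t t0 Qt] := Qmax _ Qx.
  apply: contrapT => /Qmax[s s0 Qs]; apply: Qe.
  have st0 : 0 < s + t by rewrite addr_gt0.
  suff -> : - e = (s + t)^-1 *: (s *: (- e - t *: x) + t *: (- e - s *: - x)).
    by apply/QZ; rewrite ?invr_gt0//; apply: QD; apply/QZ.
  rewrite scalerN opprK (scalerBr s) (scalerDr t) !(scalerA _ _ x) (mulrC t).
  by rewrite addrACA addNr addr0 -scalerDl scalerA mulVf ?gt_eqF// scale1r.
have Qnneg (t : R) : Q (t *: e) -> 0 <= t.
  move=> Qt; rewrite leNgt; apply/negP => t0; apply: Qe.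
  have -> : - e = (- t)^-1 *: (t *: e).
    by rewrite scalerA invrN mulNr mulVf ?lt_eqF// scaleN1r.
  by apply: QZ => //; rewrite invr_gt0 oppr_gt0.
have e_in : Q e by apply: contrapT => /Qtot.
(* The functional is the supremum of the [t] with [t *: e] below [x]. It is superadditive because
   [Q] is a wedge; totality of the preorder makes it odd, hence additive. *)
pose A x := [set t : R | Q (x - t *: e)].
have supA x : has_sup (A x).
  split.
    by have [t /PQ Qt] := Punit x; exists (- t); rewrite /A/= scaleNr opprK.
  have [t /PQ Qt] := Punit (- x); exists t => s Qs.
  rewrite -subr_ge0; apply: Qnneg; rewrite scalerBl.
  by have := QD _ _ Qs Qt; rewrite addrACA addrN add0r addrC.
pose f x := sup (A x).
have f_ub x (t : R) : Q (x - t *: e) -> t <= f x.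
  by move=> Qt; apply: sup_upper_bound.
have f_lt x (t : R) : t < f x -> Q (x - t *: e).
  move=> /(sup_gt (supA x).1)[s Qs ts].
  have -> : x - t *: e = (x - s *: e) + (s - t) *: e.
    by rewrite scalerBl addrA subrK.
  by apply: QD => //; apply: QZ => //; rewrite subr_gt0.
have f_super x y : f x + f y <= f (x + y).
  apply/ler_addgt0Pr => d d0; rewrite -lerBlDr; apply: f_ub.
  have -> : x + y - (f x + f y - d) *: e =
      (x - (f x - d / 2) *: e) + (y - (f y - d / 2) *: e).
    have -> : f x + f y - d = (f x - d / 2) + (f y - d / 2) by lra.
    by rewrite scalerDl opprD addrACA.
  by apply: QD; apply: f_lt; rewrite ltrBlDr ltrDl divr_gt0.
have f0 : f 0 = 0.
  apply/eqP; rewrite eq_le; apply/andP; split; last first.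
    by apply: f_ub; rewrite scale0r subr0.
  have := f_super 0 0; rewrite addr0; lra.
have fN x : f (- x) = - f x.
  apply/eqP; rewrite eq_le; apply/andP; split.
    by have := f_super x (- x); rewrite subrr f0; lra.
  apply/ler_addgt0Pr => d d0; rewrite -lerBlDr; apply/f_ub.
  rewrite -!opprD scaleNr; apply: Qtot => /f_ub.
  by apply/negP; rewrite -ltNge ltrDl.
have fD x y : f (x + y) = f x + f y.
  apply/eqP; rewrite eq_le f_super andbT.
  by have := f_super (x + y) (- y); rewrite addrK fN; lra.
have fZ_le (a : R) x : 0 < a -> a * f x <= f (a *: x).
  move=> a0; rewrite mulrC -ler_pdivlMr//.
  apply/ler_addgt0Pr => d d0; rewrite -lerBlDr ler_pdivlMr// mulrC.
  apply: f_ub; rewrite -scalerA -scalerBr; apply: QZ => //; apply: f_lt.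
  by rewrite ltrBlDr ltrDl.
have fZ_gt0 (a : R) x : 0 < a -> f (a *: x) = a * f x.
  move=> a0; apply/eqP; rewrite eq_le fZ_le// andbT.
  by have := fZ_le a (- x) a0; rewrite scalerN !fN mulrN lerN2.
have fZ (a : R) x : f (a *: x) = a * f x.
  have [a0|a0|->] := ltgtP a 0; [|exact: fZ_gt0|by rewrite scale0r mul0r].
  by rewrite -[a]opprK scaleNr fN fZ_gt0 ?oppr_gt0// !mulNr.
have f_lin : scalar f by move=> a x y; rewrite fD fZ.
pose F : {scalar E} := HB.pack f (GRing.isLinear.Build R E R *%R f f_lin).
exists F; split => [|x Px] /=.
  apply/eqP; rewrite eq_le; apply/andP; split; last first.
    by apply: f_ub; rewrite scale1r subrr.
  apply: ge_sup; first by case: (supA e).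
  move=> t Qt; rewrite -subr_ge0; apply: Qnneg.
  by rewrite scalerBl scale1r.
by apply: f_ub; rewrite scale0r subr0; exact: PQ.
Qed.

End wedge_functional.

(** * Wedges built from convex sets *)

Section wedge_operations.
Context {R : realType}.

Lemma convex_setP (E : lmodType R) (A : set E) : convex_set A <->
  forall (t : R) x y, 0 <= t -> t <= 1 -> A x -> A y ->
    A (t *: x + (1 - t) *: y).
Proof.
split=> cA.
  move=> t x y t0 t1 /mem_set Ax /mem_set Ay.
  exact/set_mem/(cA x y (Itv01 t0 t1) Ax Ay).
by move=> x y t /set_mem Ax /set_mem Ay; apply/mem_set; exact: (cA t%:num).
Qed.

(** A sum is twice a midpoint. *)
Lemma wedge_cone0 (E : lmodType R) (C : set E) :
  convex_cone C -> wedge [set x | x = 0 \/ C x].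
Proof.
move=> [/convex_setP cC CZ]; split; first by left.
  move=> x y [->|Cx]; first by rewrite add0r.
  move=> [->|Cy]; first by rewrite addr0; right.
  right; have h0 : 0 <= 2^-1 :> R by rewrite invr_ge0.
  have h1 : 2^-1 <= 1 :> R by lra.
  have := CZ 2 _ (ltr0n _ 2) (cC _ _ _ h0 h1 Cx Cy).
  rewrite (_ : 1 - 2^-1 = 2^-1 :> R); last by lra.
  by rewrite -scalerDr scalerA divff ?scale1r// pnatr_eq0.
by move=> t x t0 [->|Cx]; [left; rewrite scaler0|right; exact: CZ].
Qed.

(** The sum [r *: d + s *: c] is [r + s] times a convex combination of [d] and [c]; the case
    [r + s = 0] is the origin. *)
Lemma wedge_hull (E : lmodType R) (D : set E) : D !=set0 -> convex_set D ->
  wedge [set p | exists2 r : R, 0 <= r & exists2 d, D d & p = r *: d].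
Proof.
move=> [d0 Dd0] /convex_setP cD; split.
- by exists 0 => //; exists d0 => //; rewrite scale0r.
- move=> _ _ [r r0 [d Dd ->]] [s s0 [c Dc ->]].
  have [rs0|rs0] := eqVneq (r + s) 0.
    move/eqP: rs0; rewrite paddr_eq0// => /andP[/eqP-> /eqP->].
    by exists 0 => //; exists d0 => //; rewrite !scale0r addr0.
  have rs_gt0 : 0 < r + s by rewrite lt_neqAle eq_sym rs0 addr_ge0.
  exists (r + s); first exact: ltW.
  exists ((r / (r + s)) *: d + (1 - r / (r + s)) *: c).
    by apply: cD; rewrite ?divr_ge0 ?ler_pdivrMr ?(ltW rs_gt0)// mul1r lerDl.
  rewrite scalerDr !scalerA mulrBr mulr1 mulrCA divff// mulr1.
  by rewrite [r + s]addrC addrK.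
- move=> t _ t0 [r r0 [d Dd ->]].
  exists (t * r); first by rewrite mulr_ge0// ltW.
  by exists d => //; rewrite scalerA.
Qed.

Lemma wedge_add (E : lmodType R) (A B : set E) : wedge A -> wedge B ->
  wedge [set a + b | a in A & b in B].
Proof.
move=> [A0 AD AZ] [B0 BD BZ]; split.
- by exists 0 => //; exists 0 => //; rewrite addr0.
- move=> _ _ [a Aa [b Bb <-]] [c Ac [d Bd <-]].
  by exists (a + c); [exact: AD|exists (b + d); [exact: BD|rewrite addrACA]].
- move=> t _ t0 [a Aa [b Bb <-]].
  by exists (t *: a); [exact: AZ|exists (t *: b); [exact: BZ|rewrite scalerDr]].
Qed.

Lemma wedge_setX (E F : lmodType R) (A : set E) (B : set F) :
  wedge A -> wedge B -> wedge (A `*` B : set (E * F)%type).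
Proof.
move=> [A0 AD AZ] [B0 BD BZ]; split => //.
  by move=> x y [/= Ax Bx] [Ay By]; split; [exact: AD|exact: BD].
by move=> t x t0 [/= Ax Bx]; split; [exact: AZ|exact: BZ].
Qed.

End wedge_operations.

(** * Interiors of wedges *)

Section topological_wedge.
Context {R : realType} {E : tvsType R}.
Implicit Types (A C : set E) (e u v : E).

(** Scaling is continuous at [(0, u)], so small multiples of [u] stay in the translate of [A] by
    [- e]. *)
Lemma nbhs_absorb A e u : nbhs e A -> exists2 t : R, 0 < t & A (e + t *: u).
Proof.
move=> /(nbhsB (- e)); rewrite addNr => U0.
have /= := scale_continuous (0, u) (+%R (- e) @` A).
rewrite scale0r => /(_ U0)[[B1 B2] /= [/nbhs_ballP[d /= d0 dB] B2u] BU].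
have [|a Aa aE] := BU (d / 2, u).
  split => /=; last exact: nbhs_singleton.
  apply: dB; rewrite -ball_normE/= sub0r normrN gtr0_norm ?divr_gt0//.
  by rewrite ltr_pdivrMr// ltr_pMr// ltr1n.
exists (d / 2); first by rewrite divr_gt0.
by move: aE => /= <-; rewrite addNKr.
Qed.

Lemma closed_cone0 C : closed C -> convex_cone C -> C !=set0 -> C 0.
Proof.
move=> clC [_ CZ] [c Cc]; apply: clC => B B0.
have [t t0 Bt] := nbhs_absorb c B0; exists (t *: c); split; first exact: CZ.
by rewrite add0r in Bt.
Qed.

Lemma interior_wedgeD C u v : wedge C -> C° u -> C v -> C° (u + v).
Proof.
move=> [_ CD _] /(nbhsB v) Cu Cv; rewrite addrC; apply: filterS Cu.
by move=> _ [w Cw <-]; exact: CD.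
Qed.

Lemma interior_wedgeZ C (t : R) u : wedge C -> 0 < t -> C° u -> C° (t *: u).
Proof.
move=> [_ _ CZ] t0 /(nbhsZ (lt0r_neq0 t0)); apply: filterS.
by move=> _ [w Cw <-]; exact: CZ.
Qed.

Lemma interior_wedge0 C : wedge C -> C <> [set: E] -> ~ C° 0.
Proof.
move=> [_ _ CZ] CT C0; apply: CT; apply/seteqP; split => // u _.
have [t t0] := nbhs_absorb u C0; rewrite add0r.
move=> /(CZ t^-1); rewrite invr_gt0 scalerA mulVf ?gt_eqF// scale1r.
exact.
Qed.

Lemma interior_absorb C e u : C° e -> exists2 t : R, 0 < t & C° (e + t *: u).
Proof. by move=> /nbhs_interior/nbhs_absorb. Qed.

End topological_wedge.

(** * Continuity of positive functionals *)

Section positive_functional.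
Context {R : realType} {E F : tvsType R}.

(** Positivity bounds [h] below by [- h s0] on the neighbourhood [S - s0] of the origin; small
    multiples of this set and of its opposite give both sides of the estimate. *)
Lemma positive_continuous (S : set E) (h : {scalar E}) (e : F) : S° !=set0 ->
  (forall s, S s -> 0 <= h s) -> continuous (fun z => h z *: e).
Proof.
move=> [s0 Ss0] hS z.
have hz : (h x : R^o) @[x --> z] --> (h z : R^o).
  apply/cvgrPdist_le => d d0.
  have hs0 : 0 <= h s0 by apply: hS; exact: interior_subset.
  (* The added 1 keeps the denominator positive when [h s0 = 0]. *)
  pose c := d / (h s0 + 1).
  have c0 : 0 < c by rewrite divr_gt0// ltr_wpDl.
  have hc : c * h s0 <= d.
    by rewrite mulrAC ler_pdivrMr ?ltr_wpDl// ler_pM2l// lerDl.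
  have near_z (b : R) : b != 0 -> nbhs z [set z + b *: (s - s0) | s in S].
    move=> b0; have := nbhsB z (nbhsZ b0 (nbhsB (- s0) Ss0)).
    rewrite addNr scaler0 addr0; apply: filterS.
    move=> _ [_ [_ [s Ss <-] <-] <-].
    by exists s => //; rewrite (addrC s).
  have c_neq0 : c != 0 by rewrite gt_eqF.
  have cN_neq0 : - c != 0 by rewrite oppr_eq0.
  near=> x; rewrite ler_distl; apply/andP; split.
    have [s Ss <-] : [set z + (- c) *: (s - s0) | s in S] x.
      by near: x; exact: near_z.
    rewrite linearD linearZ linearB /= mulNr.
    have := mulr_ge0 (ltW c0) (hS _ Ss); lra.
  have [s Ss <-] : [set z + c *: (s - s0) | s in S] x.
    by near: x; exact: near_z.
  rewrite linearD linearZ linearB /=.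
  have := mulr_ge0 (ltW c0) (hS _ Ss); lra.
apply: (@cvg_comp E (R^o * F)%type F (fun x => (h x, e)) (fun p => p.1 *: p.2) _
  (nbhs ((h z, e) : R^o * F))); last exact: (@scale_continuous R F (h z, e)).
apply: (@cvg_pair _ _ _ (nbhs z) (nbhs (h z : R^o)) (nbhs e)).
  exact: hz.
exact: cvg_cst.
Unshelve. all: by end_near. Qed.

End positive_functional.

(** * Upper closure of a weak supremum *)

Section weak_supremum.
Context {R : realType} {Y : tvsType R} (K : set Y).
Hypotheses (K_wedge : wedge K) (K_int : K° !=set0).

Lemma ltK_fin (a b : Y) : ltK K a%:E b%:E <-> K° (b - a).
Proof.
split=> [[k Kk /(congr1 -%R)]|Kba]; first by rewrite opprK opprB => <-.
by exists (b - a) => //; rewrite opprB.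
Qed.

(* The upper closure of the weak supremum is the set of all [y] that lie
   strictly below no element: pushing such a [y] down along an interior
   direction of [K] as far as possible ends in the weak supremum. *)
Lemma addK_WSup (M : set (\bar Y)) (m0 y : Y) : M m0%:E -> ~ M +oo%E ->
  addK (WSup K M) K y%:E <-> forall m, M m%:E -> ~ K° (m - y).
Proof.
move=> Mm0 Moo; split.
  move=> [[v| |] [vM _] [k Kk]] // [<-] m Mm Kmy.
  apply: (vM _ Mm); apply/ltK_fin.
  have -> : m - v = m - (v + k) + k by rewrite opprD addrA subrK.
  exact: interior_wedgeD.
move=> yM; have [k0 Kk0] := K_int.
(* These are the [t] for which [y - t *: k0] still lies strictly below no finite element of [M];
   [m0] bounds them above. *)
pose A := [set t : R | forall m, M m%:E -> ~ K° (m - y + t *: k0)].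
have A0 : A 0 by move=> m /yM; rewrite scale0r addr0.
have A_down (m : Y) (s t : R) : s <= t -> K° (m - y + s *: k0) ->
    K° (m - y + t *: k0).
  move=> st Ks.
  have -> : m - y + t *: k0 = m - y + s *: k0 + (t - s) *: k0.
    by rewrite -[RHS]addrA -scalerDl (addrC s) subrK.
  apply: interior_wedgeD => //; apply: wedgeZ => //; first by rewrite subr_ge0.
  exact: interior_subset.
have supA : has_sup A.
  split; first by exists 0.
  have [t t0 Kt] := interior_absorb (m0 - y) Kk0.
  exists t^-1 => s As; rewrite leNgt; apply/negP => /ltW ts.
  apply: (As _ Mm0); apply: A_down ts _.
  have -> : m0 - y + t^-1 *: k0 = t^-1 *: (k0 + t *: (m0 - y)).
    by rewrite scalerDr scalerA mulVf ?gt_eqF// scale1r addrC.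
  by apply: interior_wedgeZ; rewrite ?invr_gt0.
pose s := sup A.
have s_ge0 : 0 <= s by exact: sup_upper_bound.
(* The supremum is attained because [K°] is open: a violation at [s] would persist at [s - d]. *)
have As : A s.
  move=> m Mm Ks; have [d d0] := interior_absorb (- k0) Ks.
  rewrite scalerN -addrA -scalerBl => Kd.
  suff : s <= s - d by apply/negP; rewrite -ltNge ltrBlDr ltrDl.
  apply: ge_sup; first by exists 0.
  move=> t At; rewrite leNgt; apply/negP => /ltW ts.
  exact: (At _ Mm (A_down _ _ _ ts Kd)).
have As' (t : R) : s < t -> exists2 m, M m%:E & K° (m - y + t *: k0).
  move=> st; apply: contrapT => nm.
  have /(sup_upper_bound supA) : A t by move=> m Mm Km; apply: nm; exists m.
  by apply/negP; rewrite -ltNge.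
exists (y - s *: k0)%:E; last first.
  exists (s *: k0).
    by apply: wedgeZ => //; exact: interior_subset.
  by congr EFin; rewrite subrK.
split.
  move=> [m| |] Mm //= /ltK_fin; rewrite opprB addrA addrAC; exact: As.
move=> [w| |] //=; last by exists m0%:E.
(* By openness [w] is still strictly below [y - (s + d) *: k0], which in turn is strictly below some
   [m] since [s + d] exceeds the supremum. *)
move=> /ltK_fin Kw; have [d d0 Kd] := interior_absorb (- k0) Kw.
have [m Mm Km] : exists2 m, M m%:E & K° (m - y + (s + d) *: k0).
  by apply: As'; rewrite ltrDl.
exists m%:E => //; apply/ltK_fin.
have -> : m - w = (m - y + (s + d) *: k0) + (y - s *: k0 - w + d *: - k0).
  have -> : y - s *: k0 - w + d *: - k0 = y - w - (s + d) *: k0.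
    by rewrite scalerN scalerDl opprD addrA (addrAC y).
  by rewrite addrACA subrr addr0 addrA subrK.
by apply: interior_wedgeD => //; exact: interior_subset.
Qed.

End weak_supremum.

(** * Separation by a positive continuous operator *)

Lemma vdom_fin (R : realType) (X Y Z : tvsType R) (Phi : X * Z -> \bar Y) p :
  Phi p <> -oo%E -> vdom Phi p -> exists u, Phi p = u%:E.
Proof. by rewrite /vdom/=; case: (Phi p) => // u; exists u. Qed.

Section separation.
Context {R : realType} {X Y Z : tvsType R}.
Variables (K : set Y) (S : set Z) (Phi : X * Z -> \bar Y).
Hypotheses (K_neqT : K <> [set: Y]) (K_wedge : wedge K) (K_int : K° !=set0).
Hypotheses (S_cone : convex_cone S) (S_int : S° !=set0).
Hypotheses (Phi_ninfty : forall p, Phi p <> -oo%E) (Phi_convex : Kconvex K Phi).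
Hypothesis Phi_qual :
  [set z - s | z in [set p.2 | p in vdom Phi] & s in S°] 0.
Hypothesis Phi_mono : forall (x : X) (z : Z),
  vdom Phi (x, z) -> S z -> leK K (Phi (x, 0)) (Phi (x, z)).

Let epigraph := [set p : X * Z * Y | addK [set Phi p.1] K p.2%:E].

Let epigraphP p u : epigraph (p, u) <-> exists2 v, Phi p = v%:E & K (u - v).
Proof.
split=> [[_ -> [k Kk]]|[v Phiv Kuv]]; rewrite /=.
  case: (Phi p) => [v| |] // [<-]; exists v => //.
  by rewrite addrAC subrr add0r.
exists v%:E; first by rewrite /= Phiv.
by exists (u - v) => //; congr EFin; rewrite addrC subrK.
Qed.

Variables (L : {linear X -> Y}) (y : Y).

Let base : set (Y * Z) := [set (y + q.2 - L q.1.1, - q.1.2) | q in epigraph].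

Let base_convex : convex_set base.
Proof.
apply/convex_setP => t _ _ t0 t1 [[[x z] u] epiq <-] [[[x' z'] u'] epiq' <-].
exists (t *: ((x, z), u) + (1 - t) *: ((x', z'), u')).
  by move/convex_setP : Phi_convex; apply.
rewrite /=; congr pair => /=.
  rewrite linearD !linearZ /= -!(addrA y) !scalerDr (addrACA (t *: y)).
  rewrite -scalerDl (addrC t) subrK scale1r !scalerN opprD.
  by congr (_ + _); rewrite addrACA.
by rewrite !scalerN opprD.
Qed.

(* Monotonicity along [S] is what allows the wedge below to miss [- (e, 0)]:
   it turns the hypothesis at [z = 0] into one at all [z] in [S]. *)
Lemma separating_operator :
    (forall x u, Phi (x, 0) = u%:E -> ~ K° (L x - u - y)) ->
  exists T : {linear Z -> Y}, [/\ continuous T, T @` S `<=` K &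
    forall x z u, Phi (x, z) = u%:E -> ~ K° (L x + T z - u - y)].
Proof.
move=> noK; have [e Ke] := K_int; have [K0 KD KZ] := K_wedge.
have S0_wedge := wedge_cone0 S_cone.
(* The qualification condition amounts to a point of the domain whose second component [s1] is
   interior to [S]. *)
have [_ [[x1 s1] dom1 <-] [s Ss /= /subr0_eq s1s]] := Phi_qual.
move: s1s => {s}<- in Ss.
have [u1 Phi1] := vdom_fin (@Phi_ninfty _) dom1.
have base1 : base (y + u1 - L x1, - s1).
  exists ((x1, s1), u1) => //.
  by apply/epigraphP; exists u1 => //; rewrite subrr.
pose H := [set p | exists2 r : R, 0 <= r & exists2 d, base d & p = r *: d].
have H_wedge : wedge H by apply: wedge_hull => //; exists (y + u1 - L x1, - s1).
pose B : set (Y * Z) := K `*` [set x | x = 0 \/ S x].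
have B_wedge : wedge B by exact: wedge_setX.
pose P := [set a + b | a in H & b in B].
have P_wedge : wedge P by exact: wedge_add.
have HP a : H a -> P a.
  by move=> Ha; exists a => //; exists 0; rewrite ?addr0//; case: B_wedge.
have BP b : B b -> P b.
  by move=> Bb; exists 0; [case: H_wedge|exists b; rewrite ?add0r].
(* Write [- (e, 0)] as [r] times a base point plus [(k, s)]. If [r = 0], then [e + k = 0] is
   interior to [K]; otherwise [z = r^-1 *: s] is zero or in [S], and [L x - v - y] is interior to
   [K], against [noK]. *)
have P_e : ~ P (- (e, 0)).
  move=> [_ [r r0 [_ [[[x z] u] /epigraphP[v Phiv Kuv] <-] ->]] [[k s]]].
  move=> [/= Kk Ss0] /[dup] /(congr1 fst)/= rk_eq /(congr1 snd)/=.
  rewrite oppr0 => rs_eq.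
  move: r0; rewrite le_eqVlt => /predU1P[r0|r0].
    move: rk_eq; rewrite -r0 scale0r add0r => k_eq.
    apply: (interior_wedge0 K_wedge K_neqT).
    by rewrite -(subrr e) -k_eq; exact: interior_wedgeD.
  have S0z : z = 0 \/ S z.
    have -> : z = r^-1 *: s.
      move/eqP: rs_eq; rewrite scalerN addrC subr_eq0 => /eqP ->.
      by rewrite scalerA mulVf ?gt_eqF// scale1r.
    by case: S0_wedge => _ _; apply; rewrite ?invr_gt0.
  have shift (a b c d : Y) : a - b - c = a - d - c + (d - b).
    by rewrite addrA (addrAC (a - d)) subrK addrAC.
  have Kv : K° (L x - v - y).
    have -> : L x - v - y = r^-1 *: (e + k) + (u - v).
      have -> : e + k = r *: (L x - u - y).
        rewrite (_ : L x - u - y = - (y + u - L x)); last first.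
          by rewrite opprB opprD addrA addrAC.
        by rewrite -[e]opprK -rk_eq opprD scalerN subrK.
      rewrite scalerA mulVf ?gt_eqF// scale1r.
      exact: shift.
    apply: interior_wedgeD => //; apply: interior_wedgeZ; rewrite ?invr_gt0//.
    exact: interior_wedgeD.
  case: S0z => [z0|Sz]; first by apply: noK Kv; rewrite -z0.
  have := @Phi_mono x z; rewrite /vdom/= Phiv => /(_ ltac:(by []) Sz).
  case Phi0 : (Phi (x, 0)) => [v0| |] //=; last by move/Phi_ninfty: Phi0.
  move=> [k' Kk' k'E]; apply: (noK _ _ Phi0).
  have -> : L x - v0 - y = L x - v - y + k'.
    by rewrite -[k']opprK k'E opprB; exact: shift.
  exact: interior_wedgeD.
(* The base point over [s1] contributes [- r^-1 *: s1], which the element [r^-1 *: (s1 + r *: w)] of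
   [S] corrects to [w]; the multiple [t^-1] of [e] then absorbs the remainder in [Y]. *)
have P_unit p : exists t : R, P (p + t *: (e, 0)).
  case: p => v w; have [r r0 Srw] := nbhs_absorb w Ss.
  have [t t0 Kt] := nbhs_absorb (v - r^-1 *: (y + u1 - L x1)) Ke.
  exists t^-1; exists (r^-1 *: (y + u1 - L x1, - s1)).
    exists r^-1; first by rewrite invr_ge0 ltW.
    by exists (y + u1 - L x1, - s1).
  exists (t^-1 *: (e + t *: (v - r^-1 *: (y + u1 - L x1))),
          r^-1 *: (s1 + r *: w)).
    split => /=; first by apply: KZ; rewrite ?invr_gt0.
    by right; apply: S_cone.2; rewrite ?invr_gt0.
  congr pair => /=.
    rewrite (scalerDr t^-1) scalerA mulVf ?gt_eqF// scale1r.
    by rewrite (addrC (t^-1 *: e)) addrA (addrC (r^-1 *: _)) subrK.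
  rewrite scaler0 addr0 scalerDr scalerA mulVf ?gt_eqF// scale1r scalerN.
  by rewrite addKr.
have [f [fe fP]] := wedge_functional P_wedge P_e P_unit.
pose h z := f (0, z).
have h_lin : scalar h.
  move=> a z z'; rewrite /h -linearP; congr (f _).
  by congr pair => /=; rewrite scaler0 addr0.
pose hL : {scalar Z} := HB.pack h (GRing.isLinear.Build R Z R *%R h h_lin).
have hS z : S z -> 0 <= hL z by move=> Sz; apply/fP/BP; split => //; right.
have T_lin : linear (fun z => h z *: e).
  by move=> a z z'; rewrite h_lin scalerDl scalerA.
pose T : {linear Z -> Y} := HB.pack (fun z => h z *: e)
  (GRing.isLinear.Build R Z Y *:%R (fun z => h z *: e) T_lin).
exists T; split.
- exact: (positive_continuous S_int hS).
- move=> _ [z Sz <-]; apply: wedgeZ => //; first exact: hS.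
  exact: interior_subset.
move=> x z u Phiu; rewrite /= => Kk.
(* An interior point [k] of [K] dominates a positive multiple [t *: e], so [f (k, 0)] is at least
   [t]. *)
have [t t0 Kt] := nbhs_absorb (- e) Kk.
set k := L x + _ - u - y in Kk Kt.
have f_gt0 : 0 < f (k, 0).
  have : 0 <= f (k + t *: - e, 0) by apply/fP/BP; split => //; left.
  have -> : (k + t *: - e, 0) = (k, 0) - t *: (e, 0) :> Y * Z.
    by congr pair => /=; rewrite ?scalerN// scaler0 subrr.
  by rewrite linearB linearZ /= fe mulr1 subr_ge0; exact: lt_le_trans.
(* At this base point [f] equals [h z - f (k, 0) - h z], which is negative: the choice
   [T z = h z *: e] makes the two terms in [z] cancel. *)
have : 0 <= f (y + u - L x, - z).
  apply/fP/HP; exists 1; rewrite ?ler01//.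
  exists (y + u - L x, - z); last by rewrite scale1r.
  by exists ((x, z), u) => //; apply/epigraphP; exists u => //; rewrite subrr.
have -> : (y + u - L x, - z) = h z *: (e, 0) - (k, 0) - (0, z) :> Y * Z.
  congr pair => /=; last by rewrite scaler0 !sub0r oppr0 add0r.
  rewrite subr0 /k /= 2!opprB (addrC (L x)) opprD.
  by rewrite !addrA [RHS]addrAC -!(addrA (h z *: e)) [RHS]addrC subrK.
by rewrite !linearB linearZ /= fe mulr1 -/(h z); lra.
Qed.

End separation.

(** * Equality of the epigraphs *)

Theorem theorem3p3 (R : realType) (X Y Z : tvsType R)
    (hX : hausdorff_space X) (hY : hausdorff_space Y) (hZ : hausdorff_space Z)
    (K : set Y) (K_neqT : K <> [set: Y]) (K_closed : closed K)
    (K_cone : convex_cone K) (K_int : K° !=set0)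
    (S : set Z) (S_neq0 : S !=set0) (S_cone : convex_cone S)
    (S_int : S° !=set0)
    (Phi : X * Z -> \bar Y) (Phi_ninfty : forall p, Phi p <> -oo%E)
    (Phi_proper : vproper Phi) (Phi_convex : Kconvex K Phi)
    (Phi_dom0 : [set p.2 | p in vdom Phi] 0)
    (Phi_qual : [set z - s | z in [set p.2 | p in vdom Phi] & s in S°] 0)
    (Phi_mono : forall (x : X) (z : Z),
      vdom Phi (x, z) -> S z -> leK K (Phi (x, 0)) (Phi (x, z))) :
  epi K (conj1 K (fun x => Phi (x, 0))) =
    \bigcup_(T in calL K Phi) epi K (fun L => conj2 K Phi L T) /\
  \bigcup_(T in calL K Phi) epi K (fun L => conj2 K Phi L T) =
    \bigcup_(T in calLplus S K Phi) epi K (fun L => conj2 K Phi L T).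
Proof.
have K0 : K 0.
  apply: closed_cone0 => //.
  by have [k /interior_subset Kk] := K_int; exists k.
have K_wedge : wedge K.
  have -> : K = [set x | x = 0 \/ K x].
    by apply/seteqP; split=> [k|k [->|]//] Kk; right.
  exact: wedge_cone0.
(* [addK_WSup] applies: a point of the domain over 0 gives a finite element, and [+oo] is not a
   value since [Phi] never takes [-oo]. *)
have epi1P L y : addK (conj1 K (fun x => Phi (x, 0)) L) K y%:E <->
    forall x u, Phi (x, 0) = u%:E -> ~ K° (L x - u - y).
  have [[x0 z0] dom0 /= z00] := Phi_dom0; rewrite z00 in dom0.
  have [u0 Phi0] := vdom_fin (Phi_ninfty _) dom0.
  rewrite /conj1 (@addK_WSup _ _ K K_wedge K_int _ (L x0 - u0)).
  - split=> [H x u Phiu|H m [x _]].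
      by apply: H; exists x => //; rewrite Phiu.
    by case Phiu : (Phi (x, 0)) => [u| |] //= -[<-]; exact: H.
  - by exists x0 => //; rewrite Phi0.
  - move=> [x _]; case Phiu : (Phi (x, 0)) => [u| |] //.
    by move/Phi_ninfty: Phiu.
have epi2P L T y : addK (conj2 K Phi L T) K y%:E <->
    forall x z u, Phi (x, z) = u%:E -> ~ K° (L x + T z - u - y).
  have [[x0 z0] dom0] := Phi_proper.
  have [u0 Phi0] := vdom_fin (Phi_ninfty _) dom0.
  rewrite /conj2 (@addK_WSup _ _ K K_wedge K_int _ (L x0 + T z0 - u0)).
  - split=> [H x z u Phiu|H m [[x z] _]].
      by apply: H; exists (x, z) => //; rewrite Phiu.
    by case Phiu : (Phi (x, z)) => [u| |] //= -[<-]; exact: H.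
  - by exists (x0, z0) => //; rewrite Phi0.
  - move=> [p _]; case Phiu : (Phi p) => [u| |] //.
    by move/Phi_ninfty: Phiu.
have plus_sub : \bigcup_(T in calLplus S K Phi) epi K (fun L => conj2 K Phi L T)
    `<=` \bigcup_(T in calL K Phi) epi K (fun L => conj2 K Phi L T).
  by move=> Ly [T [LT _] epiT]; exists T.
have all_sub : \bigcup_(T in calL K Phi) epi K (fun L => conj2 K Phi L T)
    `<=` epi K (conj1 K (fun x => Phi (x, 0))).
  move=> [L y] [T _ [/= cL /epi2P LT]]; split => //; apply/epi1P => x u /LT.
  by rewrite linear0 addr0.
have sub_plus : epi K (conj1 K (fun x => Phi (x, 0)))
    `<=` \bigcup_(T in calLplus S K Phi) epi K (fun L => conj2 K Phi L T).
  move=> [L y] [/= cL /epi1P Ly].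
  have [T [cT TS noK]] := separating_operator K_neqT K_wedge K_int S_cone S_int
    Phi_ninfty Phi_convex Phi_qual Phi_mono Ly.
  have epiT : addK (conj2 K Phi L T) K y%:E by apply/epi2P.
  (* The finite point [y] in the upper closure rules out that the conjugate is [[set +oo]], so [T]
     is in [calL K Phi]. *)
  exists T => //; do 2 split => //; exists L => // conjE.
  by move: epiT; rewrite conjE => -[_ -> []].
split; apply/seteqP; split => // Ly.
  by move/sub_plus/plus_sub.
by move/all_sub/sub_plus.
Qed.
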